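(* Consider the control-affine multi-agent system $\dot{\boldsymbol{x}} = F(\boldsymbol{x}) + G(\boldsymbol{x})\boldsymbol{u}$, $\boldsymbol{x}\in\mathbb{R}^N$, $\boldsymbol{u}\in\mathcal{U}\subseteq\mathbb{R}^M$. Suppose that there exist $c>1$ candidate CBFs $h_s:\mathbb{R}^N\to\mathbb{R}$ defining sets $S_s=\{\boldsymbol{x}\in\mathbb{R}^N \mid h_s(\boldsymbol{x})\ge 0\}$ for all $s\in\{1,\dots,c\}$, with $S=\bigcap_{s=1}^c S_s\neq\emptyset$, that it is known that $\mathcal{U}=\mathbb{R}^M$, and that the matrix $\boldsymbol{L}_g\in\mathbb{R}^{c\times M}$ with rows $L_Gh_1,\dots,L_Gh_c$ is not the zero matrix. Let $$H(\boldsymbol{x},\boldsymbol{k}) = 1-\sum_{s=1}^c \phi\big(h_s(\boldsymbol{x}),k_s\big),\qquad C(\boldsymbol{k})=\{\boldsymbol{x}\in\mathbb{R}^N \mid H(\boldsymbol{x},\boldsymbol{k})\ge 0\}.$$ If $\boldsymbol{k}(0)$ is such that $L_GH\neq \mathbf{0}_{1\times M}$ at $t=0$, then, under the adaptation law $\dot{\boldsymbol{k}}=\kappa(\boldsymbol{x},\boldsymbol{k})$ with $$\kappa(\boldsymbol{x},\boldsymbol{k})=\operatorname*{arg\,min}_{\boldsymbol{\mu}\in\mathbb{R}^c}\ \tfrac12(\boldsymbol{\mu}-\boldsymbol{\mu}_0)^T\boldsymbol{P}(\boldsymbol{\mu}-\boldsymbol{\mu}_0)$$ subject to $$\boldsymbol{\mu}+\alpha_k(\boldsymbol{k}-\boldsymbol{k}_{min})\ge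 0,\qquad \boldsymbol{p}^T\boldsymbol{Q}\dot{\boldsymbol{p}}+\boldsymbol{p}^T\dot{\boldsymbol{Q}}\boldsymbol{p}+\alpha_p(h_p)\ge 0,$$ the controlled CBF dynamics satisfy $L_GH\neq\mathbf{0}_{1\times M}$ for all $t\ge 0$, and thus the function $H$ is a valid CBF for the set $C(\boldsymbol{k}(t))=\{\boldsymbol{x}\in\mathbb{R}^N\mid H(\boldsymbol{x},\boldsymbol{k})\ge0\}$, for all $t\ge 0$. Here $\boldsymbol{P}\in\mathbb{R}^{c\times c}$ is a positive-definite gain matrix, $\alpha_k,\alpha_p\in\mathcal{K}_\infty$, $\boldsymbol{\mu}_0$ is the nominal $\dot{\boldsymbol{k}}$, $\boldsymbol{k}_{min}=[k_{1,min},\dots,k_{c,min}]^T$ is the vector of minimum allowable values $k_{s,min}>0$, $$\boldsymbol{p}=\Big[\tfrac{\partial\phi}{\partial h_1}\ \cdots\ \tfrac{\partial\phi}{\partial h_c}\Big]^T,\qquad \boldsymbol{Q}=\boldsymbol{I}-(\boldsymbol{N}\boldsymbol{N}^T)^T-\boldsymbol{N}\boldsymbol{N}^T+(\boldsymbol{N}\boldsymbol{N}^T)^T\boldsymbol{N}\boldsymbol{N}^T,$$ $h_p=\tfrac12\boldsymbol{p}^T\boldsymbol{Q}\boldsymbol{p}-\varepsilon$ with $\varepsilon>0$, and $\boldsymbol{N}=[\boldsymbol{n}_1\ \cdots\ \boldsymbol{n}_r]$ is such that $\{\boldsymbol{n}_1,\dots,\boldsymbol{n}_r\}$ constitutes a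 basis for the null space of $\boldsymbol{L}_g^T$, i.e. $\mathcal{N}(\boldsymbol{L}_g^T)=\mathrm{span}\{\boldsymbol{n}_1,\dots,\boldsymbol{n}_r\}$.
   Context: System: the dynamics arise by stacking $A$ agents $\dot{\boldsymbol{x}}_i=f_i(\boldsymbol{x}_i)+g_i(\boldsymbol{x}_i)\boldsymbol{u}_i$, $\boldsymbol{x}_i\in\mathbb{R}^n$, $\boldsymbol{u}_i\in\mathcal{U}_i\subseteq\mathbb{R}^m$, where $f_i:\mathbb{R}^n\to\mathbb{R}^n$ and $g_i:\mathbb{R}^n\to\mathbb{R}^{n\times m}$ are known, locally Lipschitz, and not necessarily the same for all agents. Here $F=[f_1,\dots,f_A]^T:\mathbb{R}^N\to\mathbb{R}^N$, $G=\mathrm{diag}(g_1,\dots,g_A):\mathbb{R}^N\to\mathbb{R}^{N\times M}$, and $\mathcal{U}\subseteq\mathbb{R}^M$ is the input constraint set. Notation: for differentiable $V$, $L_FV=\frac{\partial V}{\partial \boldsymbol{x}}F$ and $L_GV=\frac{\partial V}{\partial\boldsymbol{x}}G$ (a $1\times M$ row vector). $L_GH=\frac{\partial H}{\partial\boldsymbol{x}}G$ is evaluated along the trajectory $(\boldsymbol{x}(t),\boldsymbol{k}(t))$ when a time $t$ is referred to. A function $\alpha:\mathbb{R}\to\mathbb{R}$ is of class $\mathcal{K}_\infty$ if $\alpha(0)=0$ and $\alpha$ is increasing on $(-\infty,\infty)$; in the adaptation law, $\alpha_k$ and the inequality involving it are understood componentwise. Candidate CBF: a continuously differentiable $h_s:\mathbb{R}^N\to\mathbb{R}$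 (with $\frac{\partial h_s}{\partial\boldsymbol{x}}$ Lipschitz continuous) used to define $S_s$; it is not assumed to have been verified as a CBF. CBF (valid): given a set $S=\{\boldsymbol{x}\in\mathbb{R}^N\mid h(\boldsymbol{x})\ge0\}$ defined by a continuously differentiable $h:\mathbb{R}^N\to\mathbb{R}$, the function $h$ is a control barrier function (CBF) defined on a set $D\supseteq S$ if there exists a Lipschitz continuous class $\mathcal{K}_\infty$ function $\alpha:\mathbb{R}\to\mathbb{R}$ such that $\sup_{\boldsymbol{u}\in\mathcal{U}}[L_Fh(\boldsymbol{x})+L_Gh(\boldsymbol{x})\boldsymbol{u}]\ge-\alpha(h(\boldsymbol{x}))$ for all $\boldsymbol{x}\in D$. For $H$ with time-varying gains, the control-independent term $L_FH$ in this condition includes the contribution of the adaptation, $\frac{\partial H}{\partial\boldsymbol{k}}\dot{\boldsymbol{k}}$, so that the condition asks that $\boldsymbol{u}$ can be chosen with $\dot H\ge-\alpha_H(H)$ for a class $\mathcal{K}_\infty$ function $\alpha_H$. The function $\phi:\mathbb{R}_{\ge0}\times\mathbb{R}_{\ge0}\to\mathbb{R}_+$ belongs to class $\mathcal{LL}$, is continuously differentiable, and satisfies $\phi(h_s,0)=\phi(0,k_s)=\phi(0,0)=1$; for example $\phi(h_s,k_s)=e^{-h_sk_s}$. A function $\phi:\mathbb{R}\times\mathbb{R}\to\mathbb{R}$ is said to belong to class $\mathcal{LL}$ if for each fixed $r$ (resp. $s$), the function $\phi(r,s)$ is decreasing with respect to $s$ (resp. $r$) and is such that $\phi(r,s)\to0$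 for $s\to\infty$ (resp. $r\to\infty$). The gain vector is $\boldsymbol{k}=[k_1,\dots,k_c]^T$ with $0<k_s<\infty$ for every $s$. In $\boldsymbol{p}$, $\frac{\partial\phi}{\partial h_s}$ denotes the partial derivative of $\phi$ in its first argument at $(h_s(\boldsymbol{x}),k_s)$. In the adaptation law, $\dot{\boldsymbol{p}}$ and $\dot{\boldsymbol{Q}}$ are the time derivatives of $\boldsymbol{p}$ and $\boldsymbol{Q}$; the decision variable $\boldsymbol{\mu}$ enters the second constraint through $\dot{\boldsymbol{p}}$, which depends on $\dot{\boldsymbol{k}}=\boldsymbol{\mu}$.
   Formalization: The null-space basis is taken orthonormal (the claim fails for a general basis), and H is shown to satisfy the CBF condition along the trajectory, and on sets containing C(k(t)) only where the adaptation law's quadratic program has a minimizer (p, Q differentiable); set-wide it fails otherwise. *)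

(* Defs.v *)
(* MathComp-Analysis over an abstract R : realType. *)
From HB Require Import structures.
From mathcomp Require Import all_boot all_order all_algebra.
From mathcomp Require Import all_classical all_reals all_analysis.
Set Implicit Arguments.
Unset Strict Implicit.
Unset Printing Implicit Defensive.
Import Order.TTheory GRing.Theory Num.Theory.
Import numFieldNormedType.Exports.
Local Open Scope classical_set_scope.
Local Open Scope ring_scope.

(* [stackF f] and [stackG g] are F = [f_1, ..., f_A]^T and
   G = diag(g_1, ..., g_A).  The stacked dimensions N = A n and M = A m appear
   as the iterated sums required by the block-matrix operations;
   [submxcol x i] is the state x_i of agent i. *)
Definition stackF (R : realType) (A n : nat)
    (f : 'I_A -> 'cV[R]_n -> 'cV[R]_n)
    (x : 'cV[R]_(\sum_(i < A) n)) : 'cV[R]_(\sum_(i < A) n) :=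
  \mxcol_(i < A) f i (submxcol x i).

Definition stackG (R : realType) (A n m : nat)
    (g : 'I_A -> 'cV[R]_n -> 'M[R]_(n, m))
    (x : 'cV[R]_(\sum_(i < A) n)) :
    'M[R]_(\sum_(i < A) n, \sum_(j < A) m) :=
  \mxblock_(i < A, j < A) (if i == j then g i (submxcol x i) else 0).

Definition locally_lipschitz (R : realType) (V W : normedModType R)
    (f : V -> W) : Prop :=
  forall x : V, exists (L : R) (B : set V), nbhs x B /\ L.-lipschitz_B f.

Definition grad (R : realType) (N : nat) (V : 'cV[R]_N -> R)
    (x : 'cV[R]_N) : 'rV[R]_N :=
  \row_j 'D_(delta_mx j 0) V x.

Definition cont_diff (R : realType) (N : nat) (V : 'cV[R]_N -> R) : Prop :=
  (forall x, differentiable V x) /\ continuous (grad V).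

Definition lieF (R : realType) (N : nat) (F : 'cV[R]_N -> 'cV[R]_N)
    (V : 'cV[R]_N -> R) (x : 'cV[R]_N) : R :=
  (grad V x *m F x) 0 0.

Definition lieG (R : realType) (N M : nat) (G : 'cV[R]_N -> 'M[R]_(N, M))
    (V : 'cV[R]_N -> R) (x : 'cV[R]_N) : 'rV[R]_M :=
  grad V x *m G x.

Definition Lg (R : realType) (N M c : nat) (G : 'cV[R]_N -> 'M[R]_(N, M))
    (h : 'I_c -> 'cV[R]_N -> R) (x : 'cV[R]_N) : 'M[R]_(c, M) :=
  \matrix_(s < c) lieG G (h s) x.

(* Defined and increasing on the whole real line; neither continuity nor
   unboundedness is part of the definition. *)
Definition class_Kinf (R : realType) (alpha : R -> R) : Prop :=
  alpha 0 = 0 /\ {homo alpha : a b / a < b}.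

(* The monotonicity and the limits are required for a *positive* fixed argument
   and a nonnegative running one: a zero fixed argument is incompatible with
   the normalization phi(r, 0) = phi(0, s) = 1 (see [phi_ok]), and the model
   example exp (- r s) satisfies exactly this. *)
Definition class_LL (R : realType) (phi : R -> R -> R) : Prop :=
  (forall r, 0 < r ->
     (forall s s', 0 <= s -> s < s' -> phi r s' < phi r s) /\
     phi r s @[s --> +oo] --> (0 : R)) /\
  (forall s, 0 < s ->
     (forall r r', 0 <= r -> r < r' -> phi r' s < phi r s) /\
     phi r s @[r --> +oo] --> (0 : R)).

(* dphi1 phi r s is the partial derivative of phi in its first argument. *)
Definition dphi1 (R : realType) (phi : R -> R -> R) (r s : R) : R :=
  derive1 (phi ^~ s) r.

Definition dphi2 (R : realType) (phi : R -> R -> R) (r s : R) : R :=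
  derive1 (phi r) s.

(* phi is applied at (h_s(x), k_s) with k_s > 0 and, outside of S_s, with
   h_s(x) < 0; it is therefore a function on R x R, continuously differentiable
   for every positive second argument, while sign, class LL and normalization
   concern nonnegative arguments. *)
Definition phi_ok (R : realType) (phi : R -> R -> R) : Prop :=
  [/\ class_LL phi,
      forall r s : R, 0 < s ->
        [/\ differentiable (fun z : R * R => phi z.1 z.2) (r, s),
            {for ((r, s) : R * R), continuous (fun z : R * R => dphi1 phi z.1 z.2)} &
            {for ((r, s) : R * R), continuous (fun z : R * R => dphi2 phi z.1 z.2)}],
      forall r s : R, 0 <= r -> 0 <= s -> 0 < phi r s,
      forall r : R, 0 <= r -> phi r 0 = 1 &
      forall s : R, 0 <= s -> phi 0 s = 1].

Definition Hfun (R : realType) (N c : nat) (phi : R -> R -> R)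
    (h : 'I_c -> 'cV[R]_N -> R) (x : 'cV[R]_N) (k : 'cV[R]_c) : R :=
  1 - \sum_(s < c) phi (h s x) (k s 0).

Definition Cset (R : realType) (N c : nat) (phi : R -> R -> R)
    (h : 'I_c -> 'cV[R]_N -> R) (k : 'cV[R]_c) : set 'cV[R]_N :=
  [set x | 0 <= Hfun phi h x k].

(* The inequality of the CBF condition at the state x.  The control-independent
   term [drift x] is L_F h(x), plus the contribution of the adaptation when h
   has time-varying gains. *)
Definition cbf_at (R : realType) (N M : nat) (U : set 'cV[R]_M)
    (G : 'cV[R]_N -> 'M[R]_(N, M)) (drift : 'cV[R]_N -> R)
    (h : 'cV[R]_N -> R) (alpha : R -> R) (x : 'cV[R]_N) : Prop :=
  ((- alpha (h x))%:E <=
     ereal_sup [set (drift x + (lieG G h x *m u) 0 0)%:E | u in U])%E.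

Definition is_CBF (R : realType) (N M : nat) (U : set 'cV[R]_M)
    (G : 'cV[R]_N -> 'M[R]_(N, M)) (drift : 'cV[R]_N -> R)
    (h : 'cV[R]_N -> R) (D : set 'cV[R]_N) : Prop :=
  [/\ cont_diff h,
      [set x | 0 <= h x] `<=` D &
      exists alpha : R -> R,
        [/\ class_Kinf alpha,
            exists L : R, L.-lipschitz alpha &
            forall x, D x -> cbf_at U G drift h alpha x]].

(* L_F H + (dH/dk) kdot at the state x and gains k. *)
Definition driftH (R : realType) (N c : nat) (F : 'cV[R]_N -> 'cV[R]_N)
    (phi : R -> R -> R) (h : 'I_c -> 'cV[R]_N -> R)
    (k kdot : 'cV[R]_c) (x : 'cV[R]_N) : R :=
  lieF F (Hfun phi h ^~ k) x + (grad (Hfun phi h x) k *m kdot) 0 0.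

Definition pvec (R : realType) (N c : nat) (phi : R -> R -> R)
    (h : 'I_c -> 'cV[R]_N -> R) (x : 'cV[R]_N) (k : 'cV[R]_c) : 'cV[R]_c :=
  \col_s dphi1 phi (h s x) (k s 0).

(* The columns of N form an orthonormal basis of the null space of L^T: a column
   v satisfies L^T v = 0 iff the row v^T lies in [kermx L] = {w | w *m L = 0}.
   Orthonormality is what makes N N^T the orthogonal projector onto the null
   space. *)
Definition onb_null (R : realType) (c M r : nat) (L : 'M[R]_(c, M))
    (Nm : 'M[R]_(c, r)) : Prop :=
  [/\ row_free Nm^T, (Nm^T == kermx L)%MS & Nm^T *m Nm = 1%:M].

Definition Qmx (R : realType) (c r : nat) (Nm : 'M[R]_(c, r)) : 'M[R]_c :=
  1%:M - (Nm *m Nm^T)^T - Nm *m Nm^T + (Nm *m Nm^T)^T *m (Nm *m Nm^T).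

Definition hp (R : realType) (c : nat) (eps : R) (p : 'cV[R]_c)
    (Q : 'M[R]_c) : R :=
  2^-1 * (p^T *m Q *m p) 0 0 - eps.

Definition pos_def (R : realType) (c : nat) (P : 'M[R]_c) : Prop :=
  forall v : 'cV[R]_c, v != 0 -> 0 < (v^T *m P *m v) 0 0.

Definition qp_cost (R : realType) (c : nat) (P : 'M[R]_c)
    (mu0 mu : 'cV[R]_c) : R :=
  2^-1 * ((mu - mu0)^T *m P *m (mu - mu0)) 0 0.

(* The constraints of the quadratic program at (x, k), when xdot = v and
   kdot = mu.  The time derivatives of p and Q are their derivatives along
   (v, mu) and v respectively. *)
Definition qp_feasible (R : realType) (N c : nat)
    (phi : R -> R -> R) (h : 'I_c -> 'cV[R]_N -> R)
    (Q : 'cV[R]_N -> 'M[R]_c) (alphak alphap : R -> R) (kmin : 'cV[R]_c)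
    (eps : R) (v : 'cV[R]_N) (x : 'cV[R]_N) (k mu : 'cV[R]_c) : Prop :=
  let p := pvec phi h x k in
  let pdot := 'D_(v, mu)
    (fun z : 'cV[R]_N * 'cV[R]_c => pvec phi h z.1 z.2) (x, k) in
  let Qdot := 'D_v Q x in
  (forall s, 0 <= mu s 0 + alphak (k s 0 - kmin s 0)) /\
  0 <= (p^T *m Q x *m pdot + p^T *m Qdot *m p) 0 0 + alphap (hp eps p (Q x)).

(* kdot is the value prescribed by the adaptation law at (x, k): pdot and Qdot
   exist there and kdot is the minimizer of the quadratic program. *)
Definition adaptation_law (R : realType) (N c : nat)
    (phi : R -> R -> R) (h : 'I_c -> 'cV[R]_N -> R)
    (Q : 'cV[R]_N -> 'M[R]_c) (P : 'M[R]_c) (alphak alphap : R -> R)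
    (kmin : 'cV[R]_c) (eps : R) (mu0 : 'cV[R]_c) (v : 'cV[R]_N)
    (x : 'cV[R]_N) (k kdot : 'cV[R]_c) : Prop :=
  let feasible := qp_feasible phi h Q alphak alphap kmin eps v x k in
  [/\ differentiable
        (fun z : 'cV[R]_N * 'cV[R]_c => pvec phi h z.1 z.2) (x, k),
      differentiable Q x,
      feasible kdot &
      forall mu, feasible mu -> qp_cost P mu0 kdot <= qp_cost P mu0 mu].

(* Solution on [0, +oo[ of xdot(t) = w(t). *)
Definition solves (R : realType) (V : normedModType R) (x w : R -> V) : Prop :=
  {within [set t | 0 <= t], continuous x} /\
  forall t : R, 0 < t -> is_derive t 1 x (w t).

(* Main.v *)
(** If L_G H = - p^T L_g vanishes at (x, k), then Q p = 0; as Q is a projector,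
    p^T Q' p = 0 as well, and the second constraint of the quadratic program
    reads alphap (- eps) >= 0, which is false.  Feasibility of the program at a
    single instant therefore already forces L_G H <> 0, with no comparison
    argument along the trajectory, and since U = R^M the supremum in the CBF
    condition is then +oo. *)

Require Import Defs.
From HB Require Import structures.
From mathcomp Require Import all_boot all_order all_algebra.
From mathcomp Require Import all_classical all_reals all_analysis.
Set Implicit Arguments.
Unset Strict Implicit.
Unset Printing Implicit Defensive.
Import Order.TTheory GRing.Theory Num.Theory.
Import numFieldNormedType.Exports.
Local Open Scope classical_set_scope.
Local Open Scope ring_scope.

(** Leibniz rule, reduced entrywise to the scalar one; it serves to differentiate the identity
    [Q y *m Q y = Q y]. *)
Lemma is_derive_mulmx (R : realType) (V : normedModType R) (a b d : nat)
    (A : V -> 'M[R]_(a, b)) (B : V -> 'M[R]_(b, d)) (x v : V) :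
  derivable A x v -> derivable B x v ->
  is_derive x v (fun y => A y *m B y) ('D_v A x *m B x + A x *m 'D_v B x).
Proof.
move=> dA dB.
have dAc := (derivable_mxP A x v).1 dA.
have dBc := (derivable_mxP B x v).1 dB.
have dAB i j : is_derive x v (fun y => (A y *m B y) i j)
    (\sum_l (A x i l *: 'D_v (fun y => B y l j) x
             + B x l j *: 'D_v (fun y => A y i l) x)).
  rewrite (_ : (fun _ => _) = \sum_l ((fun y => A y i l) * (fun y => B y l j))).
    apply: is_derive_sum => l.
    by apply: is_deriveM; apply: derivableP.
  by apply/funext => y; rewrite mxE fct_sumE.
have dABm : derivable (fun y => A y *m B y) x v.
  by apply/derivable_mxP => i j; have [] := dAB i j.
apply: DeriveDef => //; rewrite derive_mx //; apply/matrixP => i j.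
rewrite mxE (derive_val (is_derive := dAB i j)) !mxE -big_split.
apply: eq_bigr => l _; rewrite /= !derive_mx // !mxE.
by rewrite addrC; congr (_ + _); exact: mulrC.
Qed.

(* Q Q = Q gives Q' = Q' Q + Q Q', so Q' vanishes as a quadratic form on ker Q. *)
Lemma derive_idempotent_quad (R : realType) (V : normedModType R) (c : nat)
    (Q : V -> 'M[R]_c) (x v : V) (p : 'cV[R]_c) :
  (forall y, Q y *m Q y = Q y) -> derivable Q x v ->
  Q x *m p = 0 -> p^T *m Q x = 0 -> p^T *m 'D_v Q x *m p = 0.
Proof.
move=> QQ dQ Qp pQ.
have {1}-> : 'D_v Q x = 'D_v Q x *m Q x + Q x *m 'D_v Q x.
  rewrite -[RHS](derive_val (is_derive := is_derive_mulmx dQ dQ)).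
  by congr ('D_v _ x); apply/funext.
by rewrite mulmxDr mulmxDl !mulmxA pQ !mul0mx addr0 -mulmxA Qp mulmx0.
Qed.

(** Orthonormal columns make [Nm *m Nm^T] a symmetric idempotent, so the last term of [Qmx] cancels
    one of the two subtracted copies. What remains is the orthogonal projector onto the complement
    of the column span. *)
Lemma QmxE (R : realType) (c r : nat) (Nm : 'M[R]_(c, r)) :
  Nm^T *m Nm = 1%:M -> Qmx Nm = 1%:M - Nm *m Nm^T.
Proof.
move=> NN; rewrite /Qmx trmx_mul trmxK mulmxA -[Nm *m _ *m Nm]mulmxA NN mulmx1.
by rewrite subrK.
Qed.

Lemma Qmx_idem (R : realType) (c r : nat) (Nm : 'M[R]_(c, r)) :
  Nm^T *m Nm = 1%:M -> Qmx Nm *m Qmx Nm = Qmx Nm.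
Proof.
move=> NN; rewrite QmxE // mulmxBr mulmx1 mulmxBl mul1mx mulmxA.
by rewrite -[Nm *m _ *m Nm]mulmxA NN mulmx1 subrr subr0.
Qed.

Lemma Qmx_sym (R : realType) (c r : nat) (Nm : 'M[R]_(c, r)) :
  Nm^T *m Nm = 1%:M -> (Qmx Nm)^T = Qmx Nm.
Proof. by move=> NN; rewrite QmxE // linearB /= trmx1 trmx_mul trmxK. Qed.

Lemma Qmx_null (R : realType) (c M r : nat) (L : 'M[R]_(c, M))
    (Nm : 'M[R]_(c, r)) (p : 'cV[R]_c) :
  onb_null L Nm -> p^T *m L = 0 -> p^T *m Qmx Nm = 0.
Proof.
move=> [_ /andP[_ kerN] NN] /sub_kermxP pL.
(* The columns of [Nm] span the null space, so [p^T] is [w *m Nm^T] for some [w], and [Nm^T] is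
   annihilated by the projector. *)
have /submxP[w ->] := submx_trans pL kerN.
by rewrite QmxE // mulmxBr mulmx1 !mulmxA -[w *m _ *m Nm]mulmxA NN mulmx1 subrr.
Qed.

Lemma derive_Hfun (R : realType) (N c : nat) (phi : R -> R -> R)
    (h : 'I_c -> 'cV[R]_N -> R) (k : 'cV[R]_c) (x v : 'cV[R]_N) :
  phi_ok phi -> (forall s, differentiable (h s) x) -> (forall s, 0 < k s 0) ->
  differentiable (Hfun phi h ^~ k) x /\
  'D_v (Hfun phi h ^~ k) x
    = - \sum_s dphi1 phi (h s x) (k s 0) * 'D_v (h s) x.
Proof.
move=> [_ dphi _ _ _] dh k0.
have dphis s : differentiable (phi ^~ (k s 0)) (h s x).
  have [+ _ _] := dphi (h s x) (k s 0) (k0 s).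
  (* Joint differentiability of [phi] is restricted to the line where the second argument is frozen
     at [k s 0 > 0]. *)
  apply: (@differentiable_comp _ _ _ _ (fun a : R => (a, k s 0))
    (fun z => phi z.1 z.2)).
  exact: differentiable_pair.
have dterm s : differentiable (fun y => phi (h s y) (k s 0)) x.
  exact: (@differentiable_comp _ _ _ _ (h s) (phi ^~ (k s 0))).
rewrite (_ : Hfun phi h ^~ k
   = cst 1 - \sum_s (fun y => phi (h s y) (k s 0))); last first.
  by apply/funext => y; rewrite /Hfun !fctE fct_sumE.
have dsum : differentiable (\sum_s (fun y => phi (h s y) (k s 0))) x.
  exact: differentiable_sum.
split; first exact: differentiableB.
rewrite deriveB; [|exact: derivable_cst|exact: diff_derivable].
rewrite derive_cst sub0r derive_sum; last by move=> s; apply: diff_derivable.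
congr (- _); apply: eq_bigr => s _.
rewrite deriveE // (@diff_comp _ _ _ _ (h s) (phi ^~ (k s 0))) //=.
by rewrite diff1E // deriveE // /dphi1 [RHS]mulrC.
Qed.

Lemma grad_Hfun (R : realType) (N c : nat) (phi : R -> R -> R)
    (h : 'I_c -> 'cV[R]_N -> R) (k : 'cV[R]_c) (x : 'cV[R]_N) :
  phi_ok phi -> (forall s, differentiable (h s) x) -> (forall s, 0 < k s 0) ->
  grad (Hfun phi h ^~ k) x
    = - \sum_s dphi1 phi (h s x) (k s 0) *: grad (h s) x.
Proof.
move=> phiok dh k0; apply/rowP => j; rewrite !mxE summxE.
rewrite (derive_Hfun (delta_mx j 0) phiok dh k0).2.
by congr (- _); apply: eq_bigr => s _; rewrite !mxE.
Qed.

(** Link between the CBF and the quadratic program: by the chain rule, [L_G H] vanishes exactly when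
    [p^T] lies in the left kernel of [Lg G h x], the subspace that [Q] annihilates. *)
Lemma lieG_Hfun (R : realType) (N M c : nat) (G : 'cV[R]_N -> 'M[R]_(N, M))
    (phi : R -> R -> R) (h : 'I_c -> 'cV[R]_N -> R) (k : 'cV[R]_c)
    (x : 'cV[R]_N) :
  phi_ok phi -> (forall s, differentiable (h s) x) -> (forall s, 0 < k s 0) ->
  lieG G (Hfun phi h ^~ k) x = - ((pvec phi h x k)^T *m Lg G h x).
Proof.
move=> phiok dh k0; rewrite /lieG grad_Hfun // mulNmx mulmx_suml.
congr (- _); rewrite mulmx_sum_row; apply: eq_bigr => s _.
by rewrite -scalemxAl !mxE rowK.
Qed.

Lemma cont_diff_Hfun (R : realType) (N c : nat) (phi : R -> R -> R)
    (h : 'I_c -> 'cV[R]_N -> R) (k : 'cV[R]_c) :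
  phi_ok phi -> (forall s, cont_diff (h s)) -> (forall s, 0 < k s 0) ->
  cont_diff (Hfun phi h ^~ k).
Proof.
move=> phiok ch k0; have dh x s : differentiable (h s) x by case: (ch s).
(* The direction 0 is a dummy: only the differentiability half is taken. *)
split=> [x|]; first exact: (derive_Hfun 0 phiok (dh x) k0).1.
rewrite (_ : grad _ = fun x =>
    - \sum_s dphi1 phi (h s x) (k s 0) *: grad (h s) x); last first.
  by apply/funext => x; exact: grad_Hfun.
have cterm s : continuous (fun x => dphi1 phi (h s x) (k s 0) *: grad (h s) x).
  move=> x; apply: (@continuousZ _ _ _ (fun x => dphi1 phi (h s x) (k s 0))).
    apply: (@continuous_comp _ _ _ (fun y => (h s y, k s 0))
      (fun z : R * R => dphi1 phi z.1 z.2)).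
      exact: cvg_pair (differentiable_continuous (dh x s)) (cvg_cst (k s 0)).
    by have [_ dphi _ _ _] := phiok; have [] := dphi (h s x) (k s 0) (k0 s).
  by case: (ch s) => _; apply.
move=> x; apply: (@continuousN _ _ _ (fun x => \sum_s _ *: _)).
exact: (cvg_big add_continuous (nbhs_filter x) (fun s _ => cterm s x)).
Qed.

Lemma cbf_at_unconstrained (R : realType) (N M : nat)
    (G : 'cV[R]_N -> 'M[R]_(N, M)) (drift h : 'cV[R]_N -> R) (alpha : R -> R)
    (x : 'cV[R]_N) :
  lieG G h x != 0 -> cbf_at setT G drift h alpha x.
Proof.
rewrite /cbf_at; move: (lieG G h x) => w w0.
have [j wj] : exists j, w 0 j != 0.
  apply/existsP; apply: contraNT w0 => /existsPn wj.
  by apply/eqP/rowP => j; rewrite [RHS]mxE; apply/eqP; rewrite -[_ == _]negbK wj.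
(* An input along the single coordinate [j] suffices: [a] solves
   [drift x + w 0 j * a = - alpha (h x)], so the bound is attained. *)
pose a := (- alpha (h x) - drift x) / w 0 j.
apply: ereal_sup_ubound; exists (a *: delta_mx j 0) => //=.
by congr (_%:E); rewrite -scalemxAr -colE !mxE divfK // addrC subrK.
Qed.

Lemma adaptation_law_lieG_neq0 (R : realType) (N M c : nat)
    (G : 'cV[R]_N -> 'M[R]_(N, M)) (phi : R -> R -> R)
    (h : 'I_c -> 'cV[R]_N -> R) (r : 'cV[R]_N -> nat)
    (Nm : forall y : 'cV[R]_N, 'M[R]_(c, r y)) (P : 'M[R]_c)
    (alphak alphap : R -> R) (kmin : 'cV[R]_c) (eps : R) (mu0 : 'cV[R]_c)
    (v x : 'cV[R]_N) (k kdot : 'cV[R]_c) :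
  phi_ok phi -> (forall s, differentiable (h s) x) -> (forall s, 0 < k s 0) ->
  (forall y, onb_null (Lg G h y) (Nm y)) -> class_Kinf alphap -> 0 < eps ->
  adaptation_law phi h (fun y => Qmx (Nm y)) P alphak alphap kmin eps mu0 v
    x k kdot ->
  lieG G (Hfun phi h ^~ k) x != 0.
Proof.
move=> phiok dh k0 onb [alpha0 alpha_incr] eps0 [_ dQ [_ feas] _].
apply/negP => /eqP; rewrite lieG_Hfun // => /eqP; rewrite oppr_eq0 => /eqP pL.
(* Orthonormality is taken at every [y], not only at [x], because the idempotence of [Q] is going to
   be differentiated. The rank [r y] may vary, but [Q y] keeps its size. *)
have NN y : (Nm y)^T *m Nm y = 1%:M by case: (onb y).
have pQ := Qmx_null (onb x) pL.
have Qp : Qmx (Nm x) *m pvec phi h x k = 0.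
  by apply: trmx_inj; rewrite trmx_mul Qmx_sym // pQ trmx0.
have := feas; rewrite (derive_idempotent_quad _ (diff_derivable dQ)) //; last first.
  by move=> y; exact: Qmx_idem.
(* [p^T Q = 0] removes the [pdot] term, whatever its value, and the quadratic part of [hp]; there
   remains [0 <= alphap (- eps)], against strict monotonicity and [alphap 0 = 0]. *)
rewrite /hp pQ !mul0mx addr0 mxE mulr0 sub0r add0r leNgt -alpha0.
by rewrite alpha_incr // oppr_lt0.
Qed.

(** Validity is stated twice: along the trajectory, with one [alpha] for all times, and at each
    fixed time on any [D] containing [C(k(t))] where the law holds. The feedbacks [u] and [kappa]
    take the state as an argument so that the law makes sense off the trajectory. *)
Theorem theorem1 (R : realType) (A n m c : nat)
    (f : 'I_A -> 'cV[R]_n -> 'cV[R]_n)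
    (g : 'I_A -> 'cV[R]_n -> 'M[R]_(n, m))
    (U : set 'cV[R]_(\sum_(i < A) m))
    (h : 'I_c -> 'cV[R]_(\sum_(i < A) n) -> R)
    (phi : R -> R -> R)
    (r : 'cV[R]_(\sum_(i < A) n) -> nat)
    (Nm : forall y : 'cV[R]_(\sum_(i < A) n), 'M[R]_(c, r y))
    (P : 'M[R]_c) (alphak alphap : R -> R) (kmin : 'cV[R]_c) (eps : R)
    (mu0 kappa : R -> 'cV[R]_(\sum_(i < A) n) -> 'cV[R]_c -> 'cV[R]_c)
    (u : R -> 'cV[R]_(\sum_(i < A) n) -> 'cV[R]_c ->
         'cV[R]_(\sum_(i < A) m))
    (x : R -> 'cV[R]_(\sum_(i < A) n)) (k : R -> 'cV[R]_c) :
  let F := stackF f in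
  let G := stackG g in
  let Q := fun y => Qmx (Nm y) in
  let H := Hfun phi h in
  let xdot := fun t y l => F y + G y *m u t y l in
  let law := fun t y l =>
    adaptation_law phi h Q P alphak alphap kmin eps (mu0 t y l)
      (xdot t y l) y l (kappa t y l) in
  let drift := fun t y => driftH F phi h (k t) (kappa t y (k t)) y in
  (1 < c)%N ->
  (forall i, locally_lipschitz (f i)) ->
  (forall i, locally_lipschitz (g i)) ->
  U = [set: 'cV[R]_(\sum_(i < A) m)] ->
  (forall t y l, U (u t y l)) ->
  (forall s, cont_diff (h s) /\ exists L : R, L.-lipschitz (grad (h s))) ->
  (exists y, forall s, 0 <= h s y) ->
  phi_ok phi ->
  (forall y, onb_null (Lg G h y) (Nm y)) ->
  pos_def P ->
  class_Kinf alphak ->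
  class_Kinf alphap ->
  (forall s, 0 < kmin s 0) ->
  0 < eps ->
  solves x (fun t => xdot t (x t) (k t)) ->
  solves k (fun t => kappa t (x t) (k t)) ->
  (forall (t : R) s, 0 <= t -> 0 < k t s 0) ->
  (forall t : R, 0 <= t -> Lg G h (x t) != 0) ->
  (forall t : R, 0 <= t -> law t (x t) (k t)) ->
  lieG G (H ^~ (k 0)) (x 0) != 0 ->
  [/\ forall t : R, 0 <= t -> lieG G (H ^~ (k t)) (x t) != 0,
      exists alpha : R -> R,
        [/\ class_Kinf alpha,
            exists L : R, L.-lipschitz alpha &
            forall t : R, 0 <= t ->
              cbf_at U G (drift t) (H ^~ (k t)) alpha (x t)] &
      forall (t : R) (D : set 'cV[R]_(\sum_(i < A) n)), 0 <= t ->
        Cset phi h (k t) `<=` D ->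
        (forall y, D y -> law t y (k t)) ->
        is_CBF U G (drift t) (H ^~ (k t)) D].
Proof.
move=> F G Q H xdot law drift _ _ _ -> _ ch _ phiok onb _ _ Kp _ eps0 _ _ k0 _.
move=> lawx _.
have dh s y : differentiable (h s) y by case: (ch s) => -[].
have HG t y : 0 <= t -> law t y (k t) -> lieG G (H ^~ (k t)) y != 0.
  by move=> t0; apply: adaptation_law_lieG_neq0 => // s; exact: k0.
(* With unconstrained inputs any [alpha] satisfies the inequality once [L_G H] is nonzero; the
   identity is a 1-Lipschitz choice. *)
have Kid : class_Kinf (@id R) by split.
have Lid : exists L : R, L.-lipschitz (@id R).
  by exists 1 => -[a b] _ /=; rewrite mul1r lexx.
split=> [t t0||t D t0 CD lawD]; first by apply: HG => //; exact: lawx.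
  exists id; split=> // t t0; apply: cbf_at_unconstrained.
  by apply: HG => //; exact: lawx.
split=> //; first by apply: cont_diff_Hfun => // s; [case: (ch s)|exact: k0].
exists id; split=> // y Dy; apply: cbf_at_unconstrained.
by apply: HG => //; exact: lawD.
Qed.
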